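(* Let $D$ be a non-commutative division ring that is strongly algebraic over its center $F$, let $n\ge1$, and let $N$ be a subgroup of $GL_n(D)$ containing $F^*$. Then $N$ is not finitely generated.
   Context: For a division ring $D$ with center $F$ and $S\subseteq D$, $F(S)$ denotes the division subring of $D$ generated by $F\cup S$. If every element of $D$ is algebraic over $F$, then $D$ is called strongly algebraic over $F$ if $D$ contains a maximal subfield $K$ such that (i) there exists a subset $S$ of $K$ with $K=F(S)$, and (ii) for each $x\in D$ there are at most finitely many $y\in S$ with $xy\ne yx$. (Algebraicity of $D$ over $F$ is part of the definition.) $F^*$ is identified with the group of scalar matrices $F^*I=\{\alpha I:\alpha\in F^*\}\subseteq GL_n(D)$, where $I$ is the identity matrix. *)

(* Defs.v *)
From HB Require Import structures.
From mathcomp Require Import all_boot all_algebra.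
From mathcomp Require Import mathcomp_extra boolp classical_sets cardinality.

Set Implicit Arguments.
Unset Strict Implicit.
Unset Printing Implicit Defensive.

Import GRing.Theory.
Local Open Scope classical_set_scope.
Local Open Scope ring_scope.

Definition division_ring (D : unitRingType) : Prop :=
  forall x : D, x != 0 -> x \is a GRing.unit.

Section DivisionRings.
Variable D : unitRingType.
Implicit Types K S : set D.

Definition center : set D := [set a | forall x, GRing.comm a x].

(* In [unitRingType] inversion is total and fixes non-units, so that 0^-1 = 0:
   when D is a division ring, closure under _ / _ is closure under division by
   nonzero elements. *)
Definition division_subring K : Prop := divring_closed [in K].

(* F(S), where F is the center of D. *)
Definition generated_division_subring S : set D :=
  smallest division_subring (center `|` S).

Definition subfield K : Prop :=
  division_subring K /\ {in K &, forall x y, x * y = y * x}.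

Definition maximal_subfield K : Prop :=
  subfield K /\ forall L, subfield L -> K `<=` L -> L = K.

Definition algebraic_over_center (x : D) : Prop :=
  exists p : {poly D}, [/\ p != 0, p \is a polyOver [in center] & root p x].

Definition strongly_algebraic : Prop :=
  (forall x : D, algebraic_over_center x) /\
  exists2 K, maximal_subfield K &
  exists S, [/\ S `<=` K, K = generated_division_subring S &
    forall x : D, finite_set [set y | S y /\ x * y <> y * x]].

End DivisionRings.

(* GL_n(D). MathComp's [unitmx] and ['GL_n] need commutative coefficients, so
   an element is a matrix packed with its (unique) two-sided inverse. *)
Section GeneralLinearGroup.
Variables (D : nzRingType) (n : nat).

Record GL := MkGL {
  GL_pair : 'M[D]_n * 'M[D]_n;
  _ : (GL_pair.1 *m GL_pair.2 == 1%:M) && (GL_pair.2 *m GL_pair.1 == 1%:M)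
}.

HB.instance Definition _ := [isSub for GL_pair].
HB.instance Definition _ := [Choice of GL by <:].

Definition GL_mx (g : GL) : 'M[D]_n := (val g).1.

Lemma GL_mulmxV (g : GL) : (val g).1 *m (val g).2 = 1%:M.
Proof. by case/andP: (valP g) => /eqP. Qed.

Lemma GL_mulVmx (g : GL) : (val g).2 *m (val g).1 = 1%:M.
Proof. by case/andP: (valP g) => _ /eqP. Qed.

Lemma GL_mx_inj : injective GL_mx.
Proof.
move=> g h; rewrite /GL_mx => gh; apply: val_inj.
have gh2 : (val g).2 = (val h).2.
  have -> : (val g).2 = (val g).2 *m ((val h).1 *m (val h).2).
    by rewrite GL_mulmxV mulmx1.
  by rewrite mulmxA -gh GL_mulVmx mul1mx.
by move: gh gh2; case: (val g) (val h) => [a b] [c d] /= -> ->.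
Qed.

Fact GL_one_subproof :
  ((1%:M : 'M[D]_n) *m 1%:M == 1%:M) && ((1%:M : 'M[D]_n) *m 1%:M == 1%:M).
Proof. by rewrite mulmx1 eqxx. Qed.

Definition GL_one : GL := @MkGL (1%:M, 1%:M) GL_one_subproof.

Fact GL_inv_subproof (g : GL) :
  ((val g).2 *m (val g).1 == 1%:M) && ((val g).1 *m (val g).2 == 1%:M).
Proof. by rewrite GL_mulVmx GL_mulmxV eqxx. Qed.

Definition GL_inv (g : GL) : GL :=
  @MkGL ((val g).2, (val g).1) (GL_inv_subproof g).

Fact GL_mul_subproof (g h : GL) :
  (((val g).1 *m (val h).1) *m ((val h).2 *m (val g).2) == 1%:M) &&
  (((val h).2 *m (val g).2) *m ((val g).1 *m (val h).1) == 1%:M).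
Proof.
rewrite -!mulmxA (mulmxA (val h).1) GL_mulmxV mul1mx GL_mulmxV eqxx /=.
by rewrite (mulmxA (val g).2) GL_mulVmx mul1mx GL_mulVmx.
Qed.

Definition GL_mul (g h : GL) : GL :=
  @MkGL ((val g).1 *m (val h).1, (val h).2 *m (val g).2) (GL_mul_subproof g h).

Fact GL_mulA : associative GL_mul.
Proof. by move=> g h k; apply: GL_mx_inj; rewrite /GL_mx /= mulmxA. Qed.

Fact GL_mul1 : left_id GL_one GL_mul.
Proof. by move=> g; apply: GL_mx_inj; rewrite /GL_mx /= mul1mx. Qed.

Fact GL_mulr1 : right_id GL_one GL_mul.
Proof. by move=> g; apply: GL_mx_inj; rewrite /GL_mx /= mulmx1. Qed.

Fact GL_mulV : left_inverse GL_one GL_inv GL_mul.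
Proof. by move=> g; apply: GL_mx_inj; rewrite /GL_mx /= GL_mulVmx. Qed.

Fact GL_mulrV : right_inverse GL_one GL_inv GL_mul.
Proof. by move=> g; apply: GL_mx_inj; rewrite /GL_mx /= GL_mulmxV. Qed.

HB.instance Definition _ :=
  isGroup.Build GL GL_mulA GL_mul1 GL_mulr1 GL_mulV GL_mulrV.

End GeneralLinearGroup.

(* F^* I, where F is the center of D. *)
Definition central_scalars (D : unitRingType) (n : nat) : set (GL D n) :=
  [set g | exists2 a : D, center a & a != 0 /\ GL_mx g = a%:M].

Definition subgroup (G : groupType) (N : set G) : Prop := group_closed [in N].

Definition generated_subgroup (G : groupType) (X : set G) : set G :=
  smallest (@subgroup G) X.

Definition finitely_generated (G : groupType) (N : set G) : Prop :=
  exists2 X : set G, finite_set X & N = generated_subgroup X.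

(* Main.v *)
(* Choose T cofinite in S such that the entries of given generators of N and
   two noncommuting elements lie in V, the centralizer of T. The centralizer of
   S is K, and centralizing one more algebraic element is a finite-dimensional
   step, so V has a finite basis v_1, ..., v_d as a right K-space. Let R be the
   subring of K generated by the coordinates of 1 and of the products x v_i, x
   running over the chosen elements of V. The elements of N have their entries
   in the ring E of those x which stabilize M = v_1 R + ... + v_d R. For a in
   F^*, the scalar a I is in N, hence v_1 a = a v_1 is in M and a is in R. So R
   is a finitely generated ring which contains F and is algebraic over F, thus a
   field, and a finite one by Zariski's lemma over Z. As 1 is in M, E is
   contained in the finite set M; by Wedderburn's theorem E is commutative,
   although it contains two noncommuting elements. *)
Require Import Defs.
From HB Require Import structures.
From mathcomp Require Import all_boot all_algebra all_field.
From mathcomp Require Import mathcomp_extra boolp classical_sets cardinality.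

Set Implicit Arguments.
Unset Strict Implicit.
Unset Printing Implicit Defensive.

Import GRing.Theory.
Local Open Scope classical_set_scope.
Local Open Scope ring_scope.
Definition inv_closed (R : unitRingType) (A : set R) :=
  forall x, A x -> A x^-1.

Definition subring (R : nzRingType) (A : set R) :=
  [/\ A 1, forall x y, A x -> A y -> A (x - y) &
      forall x y, A x -> A y -> A (x * y)].

(** * Zariski's lemma over the integers, for subrings of a field *)

Section Zariski.
Variable K : fieldType.

(** Evaluation at [b]; its range is the ring f(R)[b]. Subrings of [K] are given as ranges of
    morphisms, the form in which [integralOver] takes its base ring. *)
Definition adj1 (R : comNzRingType) (f : {rmorphism R -> K}) (b : K) :
    {rmorphism {poly R} -> K} :=
  horner_morph (fun x => mulrC b (f x)).

Lemma adj1X (R : comNzRingType) (f : {rmorphism R -> K}) b : adj1 f b 'X = b.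
Proof. exact: horner_morphX. Qed.

Lemma adj1C (R : comNzRingType) (f : {rmorphism R -> K}) b x :
  adj1 f b x%:P = f x.
Proof. exact: horner_morphC. Qed.

Lemma adj1E (R : comNzRingType) (f : {rmorphism R -> K}) b p :
  adj1 f b p = (map_poly f p).[b].
Proof. by []. Qed.

Lemma range_adj1 (R R' : comNzRingType) (f : {rmorphism R -> K})
    (g : {rmorphism R' -> K}) b :
  range f `<=` range g -> range g b -> range (adj1 f b) `<=` range g.
Proof.
move=> fg [c _ cb] _ [p _ <-]; elim/poly_ind: p => [|p x [q _ qE]].
  by exists 0; rewrite ?rmorph0.
have [y _ yE] : range g (f x) by apply: fg; exists x.
by exists (q * c + y); rewrite // !rmorphD !rmorphM /= adj1X adj1C qE cb yE.
Qed.

Lemma integral_range (R R' : comNzRingType) (f : {rmorphism R -> K})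
    (g : {rmorphism R' -> K}) x :
  range f `<=` range g -> integralOver f x -> integralOver g x.
Proof.
move=> fg [p pm px]; apply: (integral_root_monic (p := map_poly f p)) => //.
  exact: monic_map.
apply/integral_poly => i; rewrite coef_map /=.
have [y _ <-] : range g (f p`_i) by apply: fg; exists p`_i.
exact: integral_id.
Qed.

Lemma integral_adj1 (R R' : comNzRingType) (f : {rmorphism R -> K})
    (g : {rmorphism R' -> K}) b p :
  (forall x, integralOver g (f x)) -> integralOver g b ->
  integralOver g (adj1 f b p).
Proof.
move=> fg gb; rewrite adj1E; apply: integral_horner => //.
by apply/integral_poly => i; rewrite coef_map /=; apply: fg.
Qed.

(** Dividing the relation by its leading coefficient makes it monic, at the price of adjoining the
    inverse of that coefficient. *)
Lemma integral_localize (R : comNzRingType) (f : {rmorphism R -> K})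
    (p : {poly R}) x :
  map_poly f p != 0 -> root (map_poly f p) x ->
  exists2 c, f c != 0 & integralOver (adj1 f (f c)^-1) x.
Proof.
set q := map_poly f p => q0 qx.
have cE : f p`_(size q).-1 = lead_coef q by rewrite lead_coefE coef_map.
(* The index comes from [q], since [f] may kill the top coefficients of [p]. *)
exists p`_(size q).-1; first by rewrite cE lead_coef_eq0.
apply: (integral_root_monic (p := (lead_coef q)^-1 *: q)).
- by rewrite monicE lead_coefZ mulVf ?lead_coef_eq0.
- by rewrite rootZ // invr_eq0 lead_coef_eq0.
apply/integral_poly => i; rewrite coefZ coef_map /= -cE.
have -> : (f p`_(size q).-1)^-1 * f p`_i =
    adj1 f (f p`_(size q).-1)^-1 ('X * (p`_i)%:P).
  by rewrite rmorphM /= adj1X adj1C.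
exact: integral_id.
Qed.

(** Clearing denominators: each further power of [(f c)^-1] in Horner's scheme costs one factor
    [f c]. *)
Lemma adj1_inv_num (R : comNzRingType) (f : {rmorphism R -> K}) c p :
  f c != 0 -> exists k e, adj1 f (f c)^-1 p * f c ^+ k = f e.
Proof.
move=> c0; elim/poly_ind: p => [|p x [k [e eE]]].
  by exists 0, 0; rewrite !rmorph0 mul0r.
exists k.+1, (e + x * c ^+ k.+1).
rewrite !rmorphD !rmorphM /= adj1X adj1C mulrDl rmorphXn -eE; congr (_ + _).
by rewrite exprS mulrA mulfVK // -mulrA mulrA.
Qed.

(** The reversal of a monic equation of [x] vanishes at [x^-1]; its constant coefficient is 1, so
    its image is nonzero and [integral_localize] applies. *)
Lemma integral_inv_localize (R : comNzRingType) (f : {rmorphism R -> K}) x :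
  x != 0 -> integralOver f x -> exists2 c, f c != 0 &
    integralOver (adj1 f (f c)^-1) x^-1.
Proof.
move=> x0 [p pm px]; pose n := (size p).-1.
have sp : size p = n.+1 by rewrite prednK // size_poly_gt0 monic_neq0.
have pn : p`_n = 1 by move/monicP: pm; rewrite lead_coefE.
apply: (@integral_localize _ _ (\poly_(i < n.+1) p`_(n - i))).
  apply/eqP => /polyP /(_ 0%N); rewrite coef_map coef_poly coef0 subn0 pn /=.
  by move/eqP; rewrite rmorph1 oner_eq0.
suff E : (map_poly f (\poly_(i < n.+1) p`_(n - i))).[x^-1] * x ^+ n = 0.
  by rewrite rootE -(mulIr_eq0 _ (mulIf (expf_neq0 n x0))) E.
move: px; rewrite rootE => /eqP <-.
rewrite (@horner_coef_wide _ n.+1); last first.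
  exact: leq_trans (size_poly _ _) (size_poly _ _).
rewrite (@horner_coef_wide _ n.+1); last by rewrite -sp size_poly.
rewrite mulr_suml (reindex_inj rev_ord_inj) /=; apply: eq_bigr => i _.
rewrite !coef_map coef_poly ltn_subrL /= subSS.
have le_in : (i <= n)%N by rewrite -ltnS.
rewrite subKn // -mulrA; congr (_ * _).
have -> : x ^+ n = x ^+ (n - i) * x ^+ i by rewrite -exprD subnK.
by rewrite exprVn mulrA mulVf ?mul1r // expf_neq0.
Qed.

(* The subring f(R)[s] of K. *)
Fixpoint adj (s : seq K) :
    forall R : comNzRingType, {rmorphism R -> K} -> set K :=
  if s is b :: s' then fun R f => adj s' (adj1 f b)
  else fun R f => range f.

(* If b were transcendental, 1 + X p would divide a power of p in K[X]. *)
Lemma adj1_inv_closed_algebraic (R : comNzRingType) (f : {rmorphism R -> K})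
    b (p : {poly R}) :
  let beta := adj1 f b p in
  beta != 0 -> inv_closed (range (adj1 (adj1 f b) beta^-1)) ->
  exists2 q : {poly R}, map_poly f q != 0 & root (map_poly f q) b.
Proof.
move=> beta b0 inv; apply: contrapT => nalg.
have inj (q : {poly R}) : adj1 f b q = 0 -> map_poly f q = 0.
  move=> qb; apply/eqP; apply: contrapT => q0; apply: nalg; exists q.
    exact/negP.
  by rewrite rootE -adj1E qb.
have p0 : map_poly f p != 0.
  by apply: contraNneq b0; rewrite /beta adj1E => ->; rewrite horner0.
have cop : coprimep (1 + 'X * map_poly f p) (map_poly f p).
  apply/Bezout_eq1_coprimepP; exists (1, - 'X) => /=.
  by rewrite mul1r mulNr addrK.
have sz : (1 < size (1 + 'X * map_poly f p)%R)%N.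
  by rewrite addrC mulrC -polyC1 size_MXaddC (negbTE p0) ltnS size_poly_gt0.
have [g _ gE] : range (adj1 (adj1 f b) beta^-1) (adj1 f b (1 + 'X * p))^-1.
  apply: inv; exists (1 + 'X * p)%:P => //; exact: adj1C.
have [k [e eE]] := adj1_inv_num g b0.
have u0 : adj1 f b (1 + 'X * p) != 0.
  apply/eqP => /inj; rewrite rmorphD rmorph1 rmorphM /= map_polyX => E.
  by move: sz; rewrite E size_poly0.
have : map_poly f (p ^+ k - (1 + 'X * p) * e) = 0.
  apply: inj; rewrite rmorphB rmorphM rmorphXn -eE gE mulrA mulfV // mul1r.
  exact: subrr.
rewrite rmorphB rmorphM rmorphXn rmorphD rmorph1 rmorphM /= map_polyX.
move/eqP; rewrite subr_eq0 => /eqP E.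
have : coprimep (1 + 'X * map_poly f p) (map_poly f p ^+ k).
  by rewrite coprimep_expr.
rewrite E coprimepMr => /andP[]; rewrite coprimepp => /eqP s1.
by rewrite s1 in sz.
Qed.

(** Multiplying a monic equation of degree n + 1 for [x^-1] by x^n expresses [x^-1] as a polynomial
    in [x] over f(R). *)
Lemma integral_inv_mem (R : comNzRingType) (f : {rmorphism R -> K}) x :
  range f x -> integralOver f x^-1 -> range f x^-1.
Proof.
have [->|x0] := eqVneq x 0; first by rewrite invr0.
case=> y _ yx [p pm px]; pose n := (size p).-1.
have sp : size p = n.+1 by rewrite prednK // size_poly_gt0 monic_neq0.
have pn : p`_n = 1 by move/monicP: pm; rewrite lead_coefE.
(* In degree 0 the monic polynomial is 1, which has no root. *)
case: n => [|n] in sp pn *.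
  have pE : p = 1%:P by rewrite -pn; apply: size1_polyC; rewrite sp.
  by move: px; rewrite pE map_polyC rootC /= rmorph1 oner_eq0.
exists (- \sum_(i < n.+1) p`_i * y ^+ (n - i)) => //.
move: px; rewrite rootE => /eqP.
rewrite (@horner_coef_wide _ n.+2); last by rewrite -sp size_poly.
rewrite big_ord_recr /= coef_map pn /= rmorph1 mul1r => /eqP.
rewrite addrC addr_eq0 => /eqP E.
have := congr1 (fun z => z * x ^+ n) E; rewrite mulNr.
rewrite exprSr mulrAC exprVn mulVf ?expf_neq0 // mul1r => ->.
rewrite rmorphN; congr (- _); rewrite rmorph_sum mulr_suml.
apply: eq_bigr => i _; rewrite coef_map rmorphM rmorphXn yx /= -mulrA.
congr (_ * _); have le_in : (i <= n)%N by rewrite -ltnS.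
have -> : x ^+ n = x ^+ i * x ^+ (n - i) by rewrite -exprD subnKC.
by rewrite exprVn mulrA mulVf ?mul1r // expf_neq0.
Qed.

(* If R[b][1/beta] is a field, then b and 1/beta are algebraic over R, hence so
   are the remaining generators; inverting one element a makes them all
   integral, and a ring over which a field is integral is a field. *)
Lemma adj_inv_closed s (R : comNzRingType) (f : {rmorphism R -> K}) :
  inv_closed (adj s f) -> exists a, [/\ f a != 0,
    inv_closed (range (adj1 f (f a)^-1)) &
    forall b, b \in s -> integralOver (adj1 f (f a)^-1) b].
Proof.
elim: s R f => [|b s IH] R f /=.
  move=> inv; exists 1; rewrite rmorph1 oner_neq0 invr1; split=> // x.
  have sub : range (adj1 f 1) `<=` range f.
    by apply: range_adj1 => //; exists 1; rewrite ?rmorph1.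
  by move=> /sub/inv[y _ yx]; exists y%:P => //; rewrite adj1C.
move=> /IH[p [b0 inv ints]].
set beta := adj1 f b p in b0 inv ints.
have [q q0 qb] := adj1_inv_closed_algebraic b0 inv.
have [c c0 cb] := integral_localize q0 qb.
set g := adj1 f (f c)^-1 in cb.
have gbeta : integralOver g beta.
  apply: integral_adj1 => // x; rewrite -(adj1C f (f c)^-1).
  exact: integral_id.
have [e' e'0 e'b] := integral_inv_localize b0 gbeta.
have [k [e eE]] := adj1_inv_num e' c0; rewrite -/g in eE.
have e0 : f e != 0 by rewrite -eE mulf_neq0 // expf_neq0.
(* Inverting [c * e] inverts [c] and also [g e'], which is [f e] divided by a power of [f c]. Hence
   [b] and [beta^-1] are both integral over the range of [h]. *)
have a0 : f (c * e) != 0 by rewrite rmorphM mulf_neq0.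
set h := adj1 f (f (c * e))^-1.
have fh : range f `<=` range h.
  by move=> _ [x _ <-]; exists x%:P; rewrite // adj1C.
have gh : range g `<=` range h.
  apply: range_adj1 => //; exists (e%:P * 'X) => //.
  by rewrite rmorphM adj1C /= adj1X rmorphM invfM mulrCA mulfV // mulr1.
have g'h : range (adj1 g (g e')^-1) `<=` range h.
  apply: range_adj1 => //; exists ((c ^+ k.+1)%:P * 'X) => //.
  rewrite rmorphM adj1C /= adj1X rmorphM rmorphXn /= -eE !invfM.
  by rewrite exprSr !mulrA mulfK // mulrAC mulfV ?mul1r // expf_neq0.
have hb : integralOver h b := integral_range gh cb.
have hB p' : integralOver h (adj1 (adj1 f b) beta^-1 p').
  apply: integral_adj1 => [x|]; last exact: integral_range g'h e'b.
  apply: integral_adj1 => // y; rewrite -(adj1C f (f (c * e))^-1).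
  exact: integral_id.
exists (c * e); split=> //.
  move=> x hx; apply: integral_inv_mem => //.
  have [y _ <-] : range (adj1 (adj1 f b) beta^-1) x^-1; last exact: hB.
  apply: (inv); move: x hx.
  have fB : range f `<=` range (adj1 (adj1 f b) beta^-1).
    by move=> _ [y _ <-]; exists y%:P%:P; rewrite // !adj1C.
  move=> x [y _ <-]; apply: (range_adj1 fB) => //.
  by apply: inv; apply: fB; exists (c * e).
move=> y; rewrite in_cons => /predU1P[-> // | /ints [r rm ry]].
apply: (integral_root_monic (p := map_poly (adj1 (adj1 f b) beta^-1) r)) => //.
  exact: monic_map.
by apply/integral_poly => i; rewrite coef_map /=; apply: hB.
Qed.

Lemma adj_subring s (R : comNzRingType) (f : {rmorphism R -> K}) :
  [/\ subring (adj s f), range f `<=` adj s f & [set` s] `<=` adj s f].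
Proof.
elim: s R f => [|b s IH] R f.
  split=> //; split=> [|_ _ [x _ <-] [y _ <-]|_ _ [x _ <-] [y _ <-]].
  - by exists 1; rewrite ?rmorph1.
  - by exists (x - y); rewrite ?rmorphB.
  - by exists (x * y); rewrite ?rmorphM.
have [sA fA sub] := IH _ (adj1 f b); split=> //= [_ [x _ <-]|x /=].
  by apply: fA; exists x%:P; rewrite // adj1C.
rewrite in_cons => /predU1P[->|/sub //].
by apply: fA; exists 'X; rewrite // adj1X.
Qed.

(** Division by a monic equation of [b] leaves remainders of bounded degree, whose coefficients take
    finitely many values under [f]. *)
Lemma finite_range_adj1 (R : comNzRingType) (f : {rmorphism R -> K}) b :
  finite_set (range f) -> integralOver f b -> finite_set (range (adj1 f b)).
Proof.
move=> finf [p pm /rootP pb].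
have fin d : finite_set
    [set y | exists r : nat -> R, y = \sum_(i < d) f (r i) * b ^+ i].
  elim: d => [|d IH].
    apply: (sub_finite_set _ (finite_set1 0)) => _ [r ->] /=.
    by rewrite big_ord0.
  apply: (sub_finite_set _
    (finite_image2 (fun y z => y + z * b ^+ d) IH finf)) => _ [r ->].
  rewrite big_ord_recr; exists (\sum_(i < d) f (r i) * b ^+ i).
    by exists r.
  by exists (f (r d)).
apply: (sub_finite_set _ (fin (size p))) => _ [q _ <-].
exists (nth 0 (Pdiv.Ring.rmodp q p)).
rewrite {1}(Pdiv.RingMonic.rdivp_eq pm q) rmorphD rmorphM /= !adj1E.
rewrite pb mulr0 add0r (@horner_coef_wide _ (size p)).
  by apply: eq_bigr => i _; rewrite coef_map.
rewrite (leq_trans (size_poly _ _)) // ltnW //.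
by rewrite Pdiv.Ring.ltn_rmodp monic_neq0.
Qed.

Lemma finite_adj s (R : comNzRingType) (f : {rmorphism R -> K}) :
  finite_set (range f) -> (forall b, b \in s -> integralOver f b) ->
  finite_set (adj s f).
Proof.
elim: s R f => [|b s IH] R f //= finf ints.
have fh : range f `<=` range (adj1 f b).
  by move=> _ [x _ <-]; exists x%:P; rewrite // adj1C.
apply: IH => [|b' b's].
  by apply: finite_range_adj1 => //; apply: ints; rewrite mem_head.
by apply: (integral_range fh); apply: ints; rewrite in_cons b's orbT.
Qed.

(** By [adj_inv_closed], the image of Z[1/a] is a field over which the generators are integral. In
    characteristic p it is the finite prime field; characteristic 0 is impossible, because a prime
    larger than |a| has no inverse in Z[1/a]. *)
Lemma finite_adj_int s :
  inv_closed (adj s (intr : {rmorphism int -> K})) ->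
  finite_set (adj s (intr : {rmorphism int -> K})).
Proof.
move=> /adj_inv_closed[a [a0 inv ints]].
have [[p pch]|nch] := pselect (exists p, p \in [pchar K]).
  have p_pr := pcharf_prime pch.
  apply: finite_adj => [|b /ints].
    apply: (sub_finite_set _
      (finite_image (fun n : nat => n%:R) (finite_II p))).
    move=> _ [z _ <-]; exists `|(z %% p)%Z|%N.
      rewrite /= -ltz_nat gez0_abs ?modz_ge0 ?ltz_pmod ?ltz_nat ?prime_gt0 //.
      by rewrite -lt0n prime_gt0.
    rewrite -[RHS]/(z%:~R) [in RHS](divz_eq z p) rmorphD rmorphM /=.
    rewrite -[X in _ * X + _]/(p%:R) (pcharf0 pch) mulr0 add0r.
    rewrite -[LHS]/(`|(z %% p)%Z|%N%:Z%:~R) gez0_abs // modz_ge0 //.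
    by rewrite -lt0n prime_gt0.
  apply: integral_range; apply: range_adj1 => //.
  (* By Fermat, the power p - 2 of [a] is its inverse in the prime field. *)
  exists (a ^+ p.-2) => //; rewrite rmorphXn /=.
  apply: (mulfI a0); rewrite mulfV //; apply: (mulfI a0).
  rewrite mulr1 -!exprS; case: p p_pr pch => [|[|p]] //= _ pch.
  by rewrite -(pFrobenius_autE pch) rmorph_int.
have [q qa q_pr] := prime_above `|a|.
have inj (z : int) : z%:~R = 0 :> K -> z = 0.
  have ch0 : [pchar K] =i pred0.
    by move=> p; apply/negP => pch; apply: nch; exists p.
  case: z => n.
    by move/eqP; rewrite -[n%:~R]/(n%:R) ((pcharf0P K).1 ch0) => /eqP->.
  move/eqP; rewrite NegzE mulrNz oppr_eq0 -pmulrn.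
  by rewrite ((pcharf0P K).1 ch0).
have q0 : (q%:~R : K) != 0.
  by apply/eqP => /inj [] qE; rewrite qE in q_pr.
have [r _ rE] :
    range (adj1 (intr : {rmorphism int -> K}) (a%:~R)^-1) (q%:~R)^-1.
  by apply: inv; exists q%:Z%:P; rewrite // adj1C.
have [k [e /= eE]] := adj1_inv_num r a0.
(* Thus [q] divides a power of [a], hence [a] itself, although it exceeds |a|. *)
have : a ^+ k - q%:Z * e = 0.
  apply: inj; rewrite rmorphB rmorphM rmorphXn /= -eE rE mulrA mulfV //.
  by rewrite mul1r subrr.
move/eqP; rewrite subr_eq0 => /eqP /(congr1 absz).
rewrite abszX abszM => E.
have : (q %| `|a| ^ k)%N by rewrite E dvdn_mulr.
rewrite Euclid_dvdX // => /andP[qdvd _].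
have : (q <= `|a|)%N.
  by apply: dvdn_leq => //; rewrite absz_gt0; apply: contraNneq a0 => ->.
by rewrite leqNgt qa.
Qed.

End Zariski.

(** * Subrings and centralizers in a division ring *)

Section DivisionRing.
Variable D : unitRingType.
Implicit Types (A R Y : set D) (vs : seq D).

Lemma division_subringP A :
  division_subring A <-> subring A /\ inv_closed A.
Proof.
have inE' x : (x \in [in A]) = (x \in A) by [].
split=> [[A1 AB AV]|[[A1 AB AM] AV]].
  rewrite inE' in_setE in A1.
  have {}AB x y : A x -> A y -> A (x - y).
    by move=> Ax Ay; have := AB x y; rewrite !inE' !in_setE; apply.
  have {}AV x y : A x -> A y -> A (x / y).
    by move=> Ax Ay; have := AV x y; rewrite !inE' !in_setE; apply.
  have AVV x : A x -> A x^-1 by move=> Ax; rewrite -div1r; apply: AV.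
  split=> //; split=> // x y Ax Ay.
  by rewrite -[y]invrK; apply: AV => //; apply: AVV.
split=> [|x y|x y]; rewrite !inE' !in_setE // => xA yA; first exact: AB.
by apply: AM => //; apply: AV.
Qed.

Lemma subring0 A : subring A -> A 0.
Proof. by case=> A1 AB _; rewrite -(subrr 1); apply: AB. Qed.

Lemma subringN A x : subring A -> A x -> A (- x).
Proof.
move=> sA Ax; rewrite -sub0r; case: (sA) => _ + _; apply=> //.
exact: subring0.
Qed.

Lemma subringD A x y : subring A -> A x -> A y -> A (x + y).
Proof.
move=> sA Ax Ay; rewrite -[y]opprK; case: (sA) => _ + _; apply=> //.
exact: subringN.
Qed.

Lemma subringX A x k : subring A -> A x -> A (x ^+ k).
Proof.
move=> sA Ax; elim: k => [|k IH]; first by case: sA.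
by rewrite exprS; case: (sA) => _ _; apply.
Qed.

Lemma subring_sum A (I : finType) (F : I -> D) :
  subring A -> (forall i, A (F i)) -> A (\sum_i F i).
Proof.
move=> sA AF; apply: (big_ind A) => // [|x y]; first exact: subring0.
exact: subringD.
Qed.

Definition centralizer Y : set D := [set x | forall y, Y y -> x * y = y * x].

Lemma centralizer_subring Y : subring (centralizer Y).
Proof.
split=> [y _|x y cx cy z Yz|x y cx cy z Yz]; first by rewrite mul1r mulr1.
  by rewrite mulrBl mulrBr cx ?cy.
by rewrite -mulrA cy // !mulrA cx.
Qed.

Hypothesis hD : division_ring D.

Lemma divring_mulVr (x : D) : x != 0 -> x^-1 * x = 1.
Proof. by move/hD; apply: mulVr. Qed.

Lemma divring_mulrV (x : D) : x != 0 -> x * x^-1 = 1.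
Proof. by move/hD; apply: mulrV. Qed.

Lemma divring_mul_eq0 (x y : D) : x * y = 0 -> x != 0 -> y = 0.
Proof.
by move=> xy /divring_mulVr xV; rewrite -[y]mul1r -xV -mulrA xy mulr0.
Qed.

Lemma centralizer_division_subring Y : division_subring (centralizer Y).
Proof.
apply/division_subringP; split; first exact: centralizer_subring.
move=> x cx y Yy.
have [->|/hD ux] := eqVneq x 0; first by rewrite invr0 mul0r mulr0.
by apply: (mulrI ux); rewrite mulVKr // [in RHS]mulrA cx // mulrK.
Qed.

(** * Right modules over a subring: spans, bases and coordinates *)

(** Scalars act on the right, so that left multiplication by an element of [D] is linear. *)
Fixpoint span A vs : set D :=
  if vs is v :: vs' then
    [set x | exists2 a, A a & exists2 y, span A vs' y & x = v * a + y]
  else [set 0].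

(** Over a division subring this triangular condition is linear independence, since a nonzero
    coefficient can be inverted; see [independent_sum]. *)
Fixpoint independent A vs : Prop :=
  if vs is v :: vs' then ~ span A vs' v /\ independent A vs' else True.

Lemma span0 A vs : subring A -> span A vs 0.
Proof.
move=> sA; elim: vs => //= v vs IH; exists 0; first exact: subring0.
by exists 0; rewrite // mulr0 addr0.
Qed.

Lemma spanB A vs x y : subring A ->
  span A vs x -> span A vs y -> span A vs (x - y).
Proof.
move=> [_ AB _]; elim: vs x y => /= [_ _ -> ->|v vs IH x y].
  by rewrite subrr.
move=> [a Aa [x' xs ->]] [b Ab [y' ys ->]]; exists (a - b); first exact: AB.
exists (x' - y'); first exact: IH.
by rewrite mulrBr opprD addrACA.
Qed.

Lemma spanD A vs x y : subring A ->
  span A vs x -> span A vs y -> span A vs (x + y).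
Proof.
move=> sA xs ys; rewrite -[y]opprK; apply: spanB => //.
by rewrite -sub0r; apply: spanB => //; apply: span0.
Qed.

Lemma spanZ A vs x a : subring A -> span A vs x -> A a -> span A vs (x * a).
Proof.
move=> [_ _ AM] + Aa; elim: vs x => /= [x ->|v vs IH x]; first by rewrite mul0r.
move=> [b Ab [y ys ->]]; exists (b * a); first exact: AM.
by exists (y * a); rewrite ?mulrDl ?mulrA //; apply: IH.
Qed.

Lemma mem_span A vs v : subring A -> v \in vs -> span A vs v.
Proof.
move=> sA; elim: vs => //= w vs IH; rewrite in_cons => /predU1P[->|/IH sv].
  exists 1; first by case: sA.
  by exists 0; [apply: span0 | rewrite mulr1 addr0].
exists 0; first exact: subring0.
by exists v; rewrite // mulr0 add0r.
Qed.

Lemma sub_span A R vs : A `<=` R -> span A vs `<=` span R vs.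
Proof.
move=> AR; elim: vs => //= v vs IH _ [a Aa [y ys ->]].
by exists a; [apply: AR | exists y => //; apply: IH].
Qed.

(** The spanning half of the tower law for dimensions; as scalars act on the right, the products
    take the form [v * w]. *)
Lemma span_tower A R vs ws : subring A -> subring R ->
  R `<=` span A ws ->
  span R vs `<=` span A [seq v * w | v <- vs, w <- ws].
Proof.
move=> sA sR Rws; elim: vs => //= v vs IH _ [r Rr [y ys ->]].
have cat_l us us' : span A us `<=` span A (us ++ us').
  elim: us => /= [_ ->|u us IHu _ [a Aa [z zs ->]]]; first exact: span0.
  by exists a => //; exists z => //; apply: IHu.
have cat_r us us' : span A us' `<=` span A (us ++ us').
  elim: us => //= u us IHu z /IHu zs; exists 0; first exact: subring0.
  by exists z; rewrite // mulr0 add0r.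
apply: spanD => //; last exact/cat_r/IH.
apply: cat_l; move/Rws: Rr; elim: ws {Rws IH cat_r} r => /= [_ ->|w ws IH r].
  by rewrite mulr0.
move=> [a Aa [z zs ->]]; exists a => //; exists (v * z); first exact: IH.
by rewrite mulrDr mulrA.
Qed.

Lemma span_basis A vs : subring A -> exists ws,
  [/\ {subset ws <= vs}, independent A ws & span A vs `<=` span A ws].
Proof.
move=> sA; elim: vs => [|v vs [ws [sub ind sp]]]; first by exists [::]; split.
have [vw|vw] := pselect (span A ws v).
  exists ws; split=> [w /sub wv|//|x [a Aa [y ys ->]]].
    by rewrite in_cons wv orbT.
  by apply: spanD => //; [apply: spanZ | apply: sp].
exists (v :: ws); split=> //= [w|x [a Aa [y ys ->]]].
  by rewrite !in_cons => /predU1P[->|/sub ->]; rewrite ?eqxx ?orbT.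
by exists a => //; exists y => //; apply: sp.
Qed.

(** Coordinates over [A] in an independent list are unique: those of [v * a] are [a] at [v] and 0
    elsewhere, so they agree with the ones found in [R]. *)
Lemma independent_coef A R vs v a : division_subring A -> R `<=` A ->
  subring R ->
  independent A vs -> v \in vs -> A a -> span R vs (v * a) -> R a.
Proof.
move=> /division_subringP[sA AV] RA sR; elim: vs => //= w vs IH [wv ind] + Aa.
have wE b y : A b -> span A vs y -> w * b = y -> b = 0.
  move=> Ab ys wb; apply/eqP; apply: contrapT => /negP b0; apply: wv.
  rewrite -[w]mulr1 -(divring_mulrV b0) mulrA wb.
  by apply: spanZ => //; apply: AV.
rewrite in_cons => /predU1P[->|vvs] [r Rr [y yR E]].
  suff : a - r = 0 by move/subr0_eq => ->.
  apply: (wE _ y); [|exact: sub_span yR|by rewrite mulrBr E addrC addKr].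
  by case: sA => _ + _; apply => //; apply: RA.
have r0 : r = 0.
  apply: (wE _ (v * a - y)); [exact: RA| |by rewrite E addrK].
  apply: spanB => //; last exact: sub_span yR.
  by apply: spanZ => //; apply: mem_span.
by apply: IH => //; rewrite E r0 mulr0 add0r.
Qed.

Lemma independent_sum A vs (b : nat -> D) : division_subring A ->
  independent A vs -> (forall i, (i < size vs)%N -> A (b i)) ->
  \sum_(i < size vs) vs`_i * b i = 0 -> forall i, (i < size vs)%N -> b i = 0.
Proof.
move=> /division_subringP[sA AV]; elim: vs b => //= v vs IH b [nv ind] Ab.
rewrite big_ord_recl /= => E.
have sE : span A vs (\sum_(i < size vs) vs`_i * b i.+1).
  have Ab' i (lt_i : (i < size vs)%N) : A (b i.+1) := Ab i.+1 lt_i.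
  move=> {nv ind IH E Ab}; elim: vs b Ab' => [|w ws IH] b Ab /=.
    by rewrite big_ord0.
  rewrite big_ord_recl; exists (b 1%N); first exact: (Ab 0%N).
  eexists; last by [].
  exact: (IH (fun i => b i.+1) (fun i => Ab i.+1)).
have b0 : b 0%N = 0.
  apply/eqP; apply: contrapT => /negP b0; apply: nv.
  rewrite -[v]mulr1 -(divring_mulrV b0) mulrA; apply: spanZ => //.
    move/eqP: E; rewrite addr_eq0 => /eqP ->.
    by rewrite -sub0r; apply: spanB => //; apply: span0.
  exact/AV/Ab.
move: E; rewrite b0 mulr0 add0r => E [|i] // lt_i.
by apply: (IH (fun i => b i.+1)) => // k; apply: (Ab k.+1).
Qed.

(** * Finite dimension of a centralizer over a smaller one *)

(** Gaussian elimination with coefficients on the left and unknowns on the right; [P] is the set of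
    unknowns not yet eliminated. *)
Lemma linear_system (I : finType) d (a : I -> nat -> D) (P : {set I}) :
  (d < #|P|)%N -> exists b : I -> D,
  [/\ exists i, b i != 0, forall i, i \notin P -> b i = 0 &
      forall j, (j < d)%N -> \sum_i a i j * b i = 0].
Proof.
elim: d a P => [|d IH] a P dP.
  have [i iP] : exists i, i \in P by apply/set0Pn; rewrite -card_gt0.
  exists (fun j => (j == i)%:R); split=> //.
    by exists i; rewrite eqxx oner_neq0.
  by move=> j jP; case: eqVneq jP => // ->; rewrite iP.
have [[i0 [i0P ad0]]|nad] := pselect (exists i, i \in P /\ a i d != 0);
  last first.
  have [b [bn0 bP bE]] := IH a P (ltnW dP); exists b; split=> // j.
  rewrite ltnS leq_eqVlt => /predU1P[->|/bE //].
  rewrite big1 // => i _.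
  have [iP|/bP ->] := boolP (i \in P); last by rewrite mulr0.
  by have [->|ad] := eqVneq (a i d) 0; [rewrite mul0r | case: nad; exists i].
(* Equation [d], with pivot [c], removes the unknown [i0] from the other equations; the value of
   [i0] is then read off from equation [d]. *)
pose c := a i0 d; pose a' i j := a i j - a i0 j * c^-1 * a i d.
have [|b' [[i1 bi1] bP bE]] := IH a' (P :\ i0).
  by move: dP; rewrite (cardsD1 i0 P) i0P.
have bi0 : b' i0 = 0 by apply: bP; rewrite !inE eqxx.
pose t := \sum_i a i d * b' i.
exists (fun i => if i == i0 then - (c^-1 * t) else b' i); split=> [|i iP|j jd].
- by exists i1; case: (eqVneq i1 i0) => // E; rewrite E bi0 eqxx in bi1.
- have [E|ne] := eqVneq i i0; first by rewrite E i0P in iP.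
  by apply: bP; rewrite !inE (negbTE iP) andbF.
have -> : \sum_i a i j * (if i == i0 then - (c^-1 * t) else b' i) =
    \sum_i a' i j * b' i.
  under [RHS]eq_bigr => i _ do rewrite mulrBl -!mulrA.
  rewrite sumrB -!mulr_sumr -/t (bigD1 i0) //= [in RHS](bigD1 i0) //= eqxx bi0.
  rewrite mulr0 add0r mulrN addrC; congr (_ - _).
  by apply: eq_bigr => i /negbTE ->.
move: jd; rewrite ltnS leq_eqVlt => /predU1P[->|/bE //].
by apply: big1 => i _; rewrite /a' divring_mulrV // mul1r subrr mul0r.
Qed.

(* Artin's argument: a nonzero element of minimal support, normalised to have
   an entry 1, commutes with Y entrywise, since otherwise a commutator with an
   element of Y would have smaller support. *)
Lemma centralizing_relation (I : finType) (B : set (I -> D)) Y (b : I -> D) i :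
  (forall b c, B b -> B (fun i => b i * c)) ->
  (forall b y, B b -> Y y -> B (fun i => y * b i)) ->
  (forall b b', B b -> B b' -> B (fun i => b i - b' i)) ->
  B b -> b i != 0 ->
  exists b', [/\ B b', exists i, b' i != 0 & forall i, centralizer Y (b' i)].
Proof.
move=> Bmr Bml BB; have [m] := ubnP #|[set j | b j != 0]%SET|.
elim: m b i => // m IH b i bm Bb bi.
pose c j := b j * (b i)^-1.
have [allc|] := pselect (forall j, centralizer Y (c j)).
  exists c; split=> //; first exact: Bmr.
  by exists i; rewrite /c divring_mulrV // oner_neq0.
move/existsNP => [j] /existsNP [y] /not_implyP[Yy /eqP ne].
pose b' k := y * c k - c k * y.
apply: (IH b' j).
- rewrite ltnS in bm; apply: leq_trans bm; apply: proper_card.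
  apply/properP; split; last first.
    exists i; rewrite !inE // negbK /b' /c divring_mulrV //.
    by rewrite mulr1 mul1r subrr.
  apply/fintype.subsetP => k; rewrite !inE; apply: contraNneq => bk.
  by rewrite /b' /c bk mul0r mulr0 mul0r subrr.
- have Bc : B c by apply: Bmr.
  by apply: BB; [apply: Bml | apply: Bmr].
by rewrite /b' subr_eq0 eq_sym.
Qed.

Lemma coef_polyOver_center (p : {poly D}) k :
  p \is a polyOver [in center (D := D)] -> center p`_k.
Proof.
move=> /allP pc; have [/(mem_nth 0)/pc|/(nth_default 0) ->] := ltnP k (size p).
  by rewrite /= in_setE.
by move=> x; rewrite /GRing.comm mul0r mulr0.
Qed.

(** The dimension is at most the degree [d] of [p]. For more than [d] independent vectors v_i, the
    equations sum v_i s^j b_i = 0 with j < d have a nonzero solution, which solves them for all j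
    since p(s) = 0. By Artin's argument some nonzero solution centralizes [s] and [Y], and j = 0 is
    then a forbidden relation. *)
Lemma centralizer_extension Y s :
  (forall y, Y y -> s * y = y * s) -> algebraic_over_center s ->
  exists2 vs, forall v, v \in vs -> centralizer Y v &
    centralizer Y `<=` span (centralizer (s |` Y)) vs.
Proof.
move=> sY [p [p0 pc ps]]; pose d := (size p).-1.
have dv := centralizer_division_subring (s |` Y).
have [sC _] := (division_subringP _).1 dv.
have sp : size p = d.+1 by rewrite prednK // size_poly_gt0.
have bound vs : (forall v, v \in vs -> centralizer Y v) ->
    independent (centralizer (s |` Y)) vs -> (size vs <= d)%N.
  move=> vsY ind; rewrite leqNgt; apply/negP => lt_d.
  pose B := [set b : 'I_(size vs) -> D |
    forall j, \sum_(i < size vs) vs`_i * s ^+ j * b i = 0].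
  have [b [[i bi] _ bE]] : exists b : 'I_(size vs) -> D,
      [/\ exists i, b i != 0, forall i, i \notin [set: _]%SET -> b i = 0 &
      forall j, (j < d)%N -> \sum_(i < size vs) vs`_i * s ^+ j * b i = 0].
    apply: (@linear_system 'I_(size vs) d (fun i j => vs`_i * s ^+ j)).
    by rewrite cardsT card_ord.
  have Bb : B b.
    move=> j; elim/ltn_ind: j => j IH.
    have [/bE //|dj] := ltnP j d.
    pose c := lead_coef p.
    have c0 : c != 0 by rewrite lead_coef_eq0.
    have cen k x : p`_k * x = x * p`_k.
      exact: coef_polyOver_center.
    suff : c * \sum_(i < size vs) vs`_i * s ^+ j * b i = 0.
      by move/divring_mul_eq0; apply.
    (* The coefficients of [p] are central, and c s^j is p(s) s^(j-d) minus terms with lower powers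
       of [s]. *)
    transitivity (\sum_(i < size vs) vs`_i * (p.[s] * s ^+ (j - d)) * b i -
       \sum_(k < d) p`_k * \sum_(i < size vs) vs`_i * s ^+ (k + (j - d)) * b i).
      rewrite horner_coef sp big_ord_recr /= mulr_sumr.
      under [X in _ = _ - X]eq_bigr => k _ do rewrite mulr_sumr.
      rewrite exchange_big -sumrB; apply: eq_bigr => i' _ /=.
      rewrite mulrDl mulrDr mulrDl mulr_suml mulr_sumr mulr_suml.
      rewrite addrAC addrC -[LHS]addr0; congr (_ + _).
        rewrite -[p`_d]/(p`_(size p).-1) -lead_coefE -/c -(mulrA c) -exprD.
        rewrite subnKC // !mulrA; congr (_ * _ * _).
        by rewrite /c lead_coefE cen.
      symmetry; rewrite -sumrB big1 // => k _; apply/eqP.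
      by rewrite subr_eq0 exprD !mulrA cen.
    rewrite (rootP ps) mul0r [X in X - _]big1 ?sub0r; last first.
      by move=> i' _; rewrite mulr0 mul0r.
    rewrite big1 ?oppr0 // => k _; rewrite IH ?mulr0 //.
    by rewrite -[ltnRHS](subnKC dj) ltn_add2r.
  (* Stability of [B]: left multiplication by [s] shifts j by one, and an element of [Y] moves to
     the left past the powers of [s] and the vectors of [vs]. *)
  have [||| b' [Bb' [i' bi'] b'C]] :=
      @centralizing_relation _ B (s |` Y) b i _ _ _ Bb bi.
  - move=> b1 c Bb1 j; under eq_bigr => k _ do rewrite mulrA.
    by rewrite -mulr_suml Bb1 mul0r.
  - move=> b1 y Bb1 [->|Yy] j.
      under eq_bigr => k _ do rewrite mulrA -(mulrA _ _ s) -exprSr.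
      exact: Bb1.
    have cy : y * s ^+ j = s ^+ j * y.
      by apply: commrX; rewrite /GRing.comm sY.
    under eq_bigr => k _.
      rewrite mulrA -(mulrA _ _ y) -cy (mulrA _ y) (vsY _ (mem_nth _ _)) //.
      rewrite -!mulrA.
      over.
    rewrite -mulr_sumr; under eq_bigr => k _ do rewrite mulrA.
    by rewrite Bb1 mulr0.
  - move=> b1 b2 Bb1 Bb2 j; under eq_bigr => k _ do rewrite mulrBr.
    by rewrite sumrB Bb1 Bb2 subrr.
  pose b'' k := if insub k is Some i then b' i else 0.
  have b''E (k : 'I_(size vs)) : b'' k = b' k by rewrite /b'' valK.
  move: bi'; rewrite -b''E (independent_sum dv ind) ?eqxx //.
    by move=> k lt_k; rewrite -[k]/(val (Ordinal lt_k)) b''E.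
  under eq_bigr => k _ do rewrite b''E -[vs`_k]mulr1 -(expr0 s).
  exact: Bb'.
(* Here [n] bounds how many vectors can still be added; one outside the span is added until the list
   spans the centralizer of [Y]. *)
have ext n vs : (d - size vs <= n)%N ->
    (forall v, v \in vs -> centralizer Y v) ->
    independent (centralizer (s |` Y)) vs ->
    exists2 vs, forall v, v \in vs -> centralizer Y v &
      centralizer Y `<=` span (centralizer (s |` Y)) vs.
  elim: n vs => [|n IH] vs le_n vsY ind;
    have [?|/existsNP[v /not_implyP[Yv nv]]] :=
      pselect (centralizer Y `<=` span (centralizer (s |` Y)) vs).
  - by exists vs.
  - have : (size (v :: vs) <= d)%N.
      by apply: bound => //= w; rewrite in_cons => /predU1P[->//|/vsY].
    by rewrite /= ltnNge -subn_eq0 -leqn0 le_n.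
  - by exists vs.
  - apply: (IH (v :: vs)) => //=; first by rewrite subnS; case: (d - _)%N le_n.
    by move=> w; rewrite in_cons => /predU1P[->//|/vsY].
by apply: (ext d [::]); rewrite ?leq_subr.
Qed.

(** The elements of [l] join the centralized set one at a time; each step is finite-dimensional by
    [centralizer_extension], and [span_tower] composes the steps. *)
Lemma centralizer_tower Y (l : seq D) :
  (forall x y, (Y y \/ y \in l) -> x \in l -> x * y = y * x) ->
  (forall x, x \in l -> algebraic_over_center x) ->
  exists2 vs, forall v, v \in vs -> centralizer Y v &
    centralizer Y `<=` span (centralizer (Y `|` [set` l])) vs.
Proof.
elim: l Y => [|s l IH] Y comm alg.
  exists [:: 1] => [v|x xY /=].
    by rewrite inE => /eqP ->; case: (centralizer_subring Y).
  exists x; first by move=> y [/xY|].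
  by exists 0; rewrite ?mul1r ?addr0.
have [||vs vsY vsp] := @centralizer_extension Y s.
- by move=> y Yy; apply: comm; [left | rewrite mem_head].
- by apply: alg; rewrite mem_head.
have [||ws wsY wsp] := IH (s |` Y).
- move=> x y yP xl; apply: comm; last by rewrite in_cons xl orbT.
  case: yP => [[->|]|yl]; [right|by left|right]; first by rewrite mem_head.
  by rewrite in_cons yl orbT.
- by move=> x xl; apply: alg; rewrite in_cons xl orbT.
have E : (s |` Y) `|` [set` l] = Y `|` [set` s :: l].
  apply/seteqP; split=> x /=.
    move=> [[->|Yx]|xl]; [right|by left|right]; first by rewrite mem_head.
    by rewrite in_cons xl orbT.
  move=> [Yx|]; first by left; right.
  by rewrite in_cons => /predU1P[->|xl]; [left; left | right].
rewrite E in wsp; exists [seq v * w | v <- vs, w <- ws].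
  move=> _ /allpairsP[[v w] /= [/vsY Yv /wsY wY ->]].
  case: (centralizer_subring Y) => _ _; apply=> // y Yy.
  by apply: wY; right.
by move=> x /vsp; apply: span_tower => //; apply: centralizer_subring.
Qed.

End DivisionRing.

(** * Division subrings as rings of their own, and Wedderburn's theorem *)

Section SubDivisionRing.
Variables (D : unitRingType) (A : set D).

Definition sub_divring of division_ring D & division_subring A : Type :=
  {x : D | x \in A}.

Variables (hD : division_ring D) (hA : division_subring A).
Local Notation T := (sub_divring hD hA).
HB.instance Definition _ := [isSub of T for sval].
HB.instance Definition _ := [Choice of T by <:].
HB.instance Definition _ :=
  GRing.SubChoice_isSubUnitRing.Build D [in A] T (hA : divring_closed [in A]).

Lemma sub_divring_unit (x : T) : x != 0 -> x \is a GRing.unit.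
Proof.
move=> x0; have vx0 : val x != 0.
  by apply: contraNneq x0 => vx; apply/eqP/val_inj; rewrite vx rmorph0.
have [_ inv] := (division_subringP _).1 hA.
have Ax : (val x)^-1 \in A.
  by rewrite in_setE; apply: inv; rewrite -in_setE; apply: valP.
pose y : T := Sub (val x)^-1 Ax.
apply/unitrP; exists y; split; apply: val_inj; rewrite rmorphM rmorph1 /=.
  exact: divring_mulVr.
exact: divring_mulrV.
Qed.

(** Wedderburn's little theorem, in the form [finDomain_mulrC]; a list of the elements of [A] gives
    the finite type that it requires. *)
Lemma finite_sub_divring_comm :
  finite_set A -> {in A &, commutative (@GRing.mul D)}.
Proof.
move=> /finite_seqP[s As].
pose e : seq T := undup (pmap insub s).
have me x : x \in e.
  rewrite mem_undup mem_pmap_sub.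
  have : val x \in A := valP x.
  by rewrite in_setE [A _](congr1 (fun B => B (val x)) As).
have fin : Finite.axiom e by move=> x; rewrite count_uniq_mem ?undup_uniq // me.
have eK : cancel (index^~ e) (nth 0 e) by move=> x; apply: nth_index.
pose F : finUnitRingType :=
  HB.pack T (CanIsCountable eK) (isFinite.Build T fin).
have dom : GRing.integral_domain_axiom F.
  move=> x y xy; have [//|x0] := eqVneq x 0; have ux := sub_divring_unit x0.
  by apply/eqP; apply: (mulrI ux); rewrite mulr0.
move=> x y Ax Ay.
have := finDomain_mulrC dom (Sub x Ax : T) (Sub y Ay : T).
by move/(congr1 val); rewrite !rmorphM.
Qed.

End SubDivisionRing.

(** * Finitely generated subrings, spans over them and their stabilizers *)

(** The witness is the ring Z[s]; with [A] viewed as a field, [finite_adj_int] applies to it. *)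
Lemma zariski_subfield (D : unitRingType) (A : set D) (s : seq D) :
  division_ring D -> subfield A -> (forall x, x \in s -> A x) ->
  exists R : set D, [/\ subring R, R `<=` A, forall x, x \in s -> R x &
    inv_closed R -> finite_set R].
Proof.
move=> hD [hA comm] sA.
have TC : commutative (@GRing.mul (sub_divring hD hA)).
  move=> x y; apply: val_inj; rewrite !rmorphM /=; apply: comm; exact: valP.
pose C : comUnitRingType := HB.pack (sub_divring hD hA)
  (GRing.PzRing_hasCommutativeMul.Build (sub_divring hD hA) TC).
pose F : fieldType := HB.pack C
  (GRing.ComUnitRing_isField.Build C (@sub_divring_unit D A hD hA)).
pose v (x : F) : D := val (x : sub_divring hD hA).
have vB x y : v (x - y) = v x - v y by exact: rmorphB.
have vM x y : v (x * y) = v x * v y by exact: rmorphM.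
have vV x : v (x^-1) = (v x)^-1 by [].
have v_inj : injective v by exact: val_inj.
pose t : seq F := pmap insub s.
pose f : {rmorphism int -> F} := intr.
have [[A1 AB AM] _ At] := adj_subring t f.
exists (v @` adj t f); split.
- split=> [|_ _ [x Ax <-] [y Ay <-]|_ _ [x Ax <-] [y Ay <-]].
  + by exists 1 => //; apply: rmorph1.
  + by exists (x - y); [apply: AB|].
  + by exists (x * y); [apply: AM|].
- by move=> _ [x _ <-]; rewrite -in_setE; apply: valP.
- move=> x xs; have xA : x \in A by rewrite in_setE; apply: sA.
  exists (Sub x xA : sub_divring hD hA); last exact: SubK.
  by apply: At => /=; rewrite mem_pmap_sub.
move=> inv; apply: finite_image; apply: finite_adj_int => x Ax.
have [|y Ay yx] := inv (v x); first by exists x.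
by rewrite -vV in yx; rewrite -(v_inj _ _ yx).
Qed.

(** The list [cs] gathers the coefficients of one expansion of each element of [xs]. It precedes [R]
    because the ring used for [R] is later constructed from [cs]. *)
Lemma span_coefs (D : unitRingType) (A : set D) (vs xs : seq D) :
  (forall x, x \in xs -> span A vs x) ->
  exists2 cs : seq D, forall c, c \in cs -> A c &
    forall R : set D, (forall c, c \in cs -> R c) ->
      forall x, x \in xs -> span R vs x.
Proof.
have one x : span A vs x -> exists2 cs : seq D, forall c, c \in cs -> A c &
    forall R : set D, (forall c, c \in cs -> R c) -> span R vs x.
  elim: vs x => /= [_ ->|v vs IH _ [a Aa [y /IH[cs csA csR] ->]]].
    by exists [::].
  exists (a :: cs) => [c|R Rcs].
    by rewrite in_cons => /predU1P[->|/csA].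
  exists a; first by apply: Rcs; rewrite mem_head.
  exists y => //; apply: csR => c ccs.
  by apply: Rcs; rewrite in_cons ccs orbT.
elim: xs => [_|x xs IH xsp]; first by exists [::].
have [|cs csA csR] := IH.
  by move=> y ys; apply: xsp; rewrite in_cons ys orbT.
have [|cs' csA' csR'] := one x; first by apply: xsp; rewrite mem_head.
exists (cs ++ cs') => [c|R Rcs y].
  by rewrite mem_cat => /orP[/csA|/csA'].
have [Rcs1 Rcs2] : (forall c, c \in cs -> R c) /\ (forall c, c \in cs' -> R c).
  by split=> c ccs; apply: Rcs; rewrite mem_cat ccs ?orbT.
by rewrite in_cons => /predU1P[->|ys]; [apply: csR' | apply: csR].
Qed.

Lemma finite_span (D : unitRingType) (R : set D) (vs : seq D) :
  finite_set R -> finite_set (span R vs).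
Proof.
move=> finR; elim: vs => [|v vs IH] /=; first exact: finite_set1.
apply: (sub_finite_set _ (finite_image2 (fun a y => v * a + y) finR IH)).
by move=> _ [a Ra [y ys ->]]; exists a => //; exists y.
Qed.

(** In the language of lattices, the left order of v_1 R + ... + v_d R. *)
Definition span_stabilizer (D : unitRingType) (R : set D) (vs : seq D) :
    set D :=
  [set x | forall y, span R vs y -> span R vs (x * y)].

Lemma span_stabilizer_subring (D : unitRingType) (R : set D) (vs : seq D) :
  subring R -> subring (span_stabilizer R vs).
Proof.
move=> sR; split=> [y|x x' xs xs' y ys|x x' xs xs' y ys].
- by rewrite mul1r.
- by rewrite mulrBl; apply: spanB => //; [apply: xs | apply: xs'].
- by rewrite -mulrA; apply/xs/xs'.
Qed.

Lemma span_stabilizerP (D : unitRingType) (R : set D) (vs : seq D) x :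
  subring R -> (forall v, v \in vs -> span R vs (x * v)) ->
  span_stabilizer R vs x.
Proof.
move=> sR xvs y.
have gen us : {subset us <= vs} -> span R us y -> span R vs (x * y).
  elim: us y => /= [y _ ->|v us IH y sub]; first by rewrite mulr0; apply: span0.
  move=> [a Ra [z zs ->]]; rewrite mulrDr mulrA; apply: spanD => //.
    by apply: spanZ => //; apply/xvs/sub; rewrite mem_head.
  by apply: IH zs => w wus; apply: sub; rewrite in_cons wus orbT.
exact: gen.
Qed.

(** Cancelling factors X from the equation makes its constant coefficient [c] nonzero. Then q(x) x =
    -c gives x^-1 = -c^-1 q(x), with c^-1 central. *)
Lemma algebraic_inv_mem (D : unitRingType) (R : set D) x :
  division_ring D -> subring R -> center (D := D) `<=` R ->
  algebraic_over_center x -> R x -> R x^-1.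
Proof.
move=> hD sR FR [p [p0 pc px]] Rx.
have [->|x0] := eqVneq x 0; first by rewrite invr0; apply: subring0.
have {}pc i := coef_polyOver_center i pc.
have RM : forall y z, R y -> R z -> R (y * z) by case: sR.
elim/poly_ind: p p0 pc px => [|q c IH]; first by rewrite eqxx.
move=> p0 pc; rewrite rootE hornerMXaddC => /eqP qx.
have qc i : center q`_i by have := pc i.+1; rewrite coefD coefMX coefC addr0.
have cc : center c by have := pc 0%N; rewrite coefD coefMX coefC add0r.
have [c0|c0] := eqVneq c 0.
  rewrite c0 addr0 in qx; apply: IH => //.
    by apply: contraNneq p0 => ->; rewrite c0 mul0r addr0.
  apply/rootP; have /mulIr := hD _ x0; apply; by rewrite qx mul0r.
have Rq : R q.[x].
  rewrite horner_coef; apply: subring_sum => // i; apply: RM; first exact/FR/qc.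
  exact: subringX.
have Rcq : R (- c^-1).
  apply: subringN => //; apply: FR => y.
  have cen : centralizer [set: D] c by move=> z _; apply: cc.
  have [_ inv] :=
    (division_subringP _).1 (centralizer_division_subring hD [set: D]).
  exact: inv cen y I.
suff -> : x^-1 = - c^-1 * q.[x] by apply: RM.
have /mulIr := hD _ x0; apply.
rewrite divring_mulVr // -mulrA mulNr -mulrN.
by move/eqP: qx; rewrite addr_eq0 => /eqP ->; rewrite opprK divring_mulVr.
Qed.

(** * Invertible matrices with entries in a subring *)

(** The condition on the inverse matrix makes this a subgroup for an arbitrary subring [E]. *)
Definition GL_entries_in (D : unitRingType) (n : nat) (E : set D) :
    set (GL D n) :=
  [set g : GL D n | forall i j, E ((val g).1 i j) /\ E ((val g).2 i j)].

Lemma GL_entries_in_subgroup (D : unitRingType) (n : nat) (E : set D) :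
  subring E -> subgroup (@GL_entries_in D n E).
Proof.
move=> sE; split=> [|g h].
  have E1 i j : E ((1%:M : 'M[D]_n) i j).
    rewrite mxE; case: (i == j); first by case: sE.
    exact: subring0.
  rewrite -[_ \in _]/(_ \in GL_entries_in E) in_setE => i j.
  by split; apply: E1.
rewrite -[g \in _]/(_ \in GL_entries_in E) -[h \in _]/(_ \in GL_entries_in E).
rewrite -[(g / h)%g \in _]/(_ \in GL_entries_in E) !in_setE => gE hE i j.
have EM : forall y z, E y -> E z -> E (y * z) by case: sE.
split; rewrite /= mxE; apply: subring_sum => // k; apply: EM.
- by have [] := gE i k.
- by have [] := hE k j.
- by have [] := hE i k.
- by have [] := gE k j.
Qed.

(** * Subgroups of GL_n(D) containing F^* are not finitely generated *)

Unset Implicit Arguments.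

Theorem theorem4p4 (D : unitRingType) (hD : division_ring D)
    (hnc : exists x y : D, x * y != y * x)
    (hsa : strongly_algebraic D)
    (n : nat) (hn : (1 <= n)%N)
    (N : set (GL D n)) (hN : subgroup N) (hFN : @central_scalars D n `<=` N) :
  ~ finitely_generated N.
Proof.
move=> [X /finite_seqP[gs XE] NE].
have [x0 [y0 xy0]] := hnc.
have [alg [K [hK Kmax] [S [SK KE Sfin]]]] := hsa.
pose entries (A : 'M[D]_n) := [seq A i j | i <- enum 'I_n, j <- enum 'I_n].
(* The generators enter together with their inverses, as [GL_entries_in] demands. *)
pose es := [:: x0; y0] ++
  flatten [seq entries (val g).1 ++ entries (val g).2 | g <- gs].
have mem_entries (A : 'M[D]_n) i j : A i j \in entries A.
  by apply/allpairsP; exists (i, j); rewrite !mem_enum.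
have esg g i j : g \in gs -> (val g).1 i j \in es /\ (val g).2 i j \in es.
  move=> ggs; rewrite !mem_cat; split; apply/orP; right; apply/flattenP;
    exists (entries (val g).1 ++ entries (val g).2);
    by [apply: map_f | rewrite mem_cat mem_entries ?orbT].
have [l [lS lE]] : exists l : seq D, (forall y, y \in l -> S y) /\
    forall x y, x \in es -> S y -> y \notin l -> x * y = y * x.
  elim: {esg} es => [|x es [l [lS lE]]]; first by exists [::]; split.
  have /finite_seqP[l' l'E] := Sfin x.
  have l'P y : (y \in l') = `[< S y /\ x * y <> y * x >].
    by apply/idP/asboolP;
      rewrite -[_ /\ _]/([set y | S y /\ x * y <> y * x] y) l'E.
  exists (l' ++ l); split=> [y|z y].
    by rewrite mem_cat l'P => /orP[/asboolP[]|/lS].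
  rewrite in_cons mem_cat negb_or => /predU1P[->|zes] Sy /andP[yl' yl].
    by apply: contrapT => ne; case/negP: yl'; rewrite l'P; apply/asboolP.
  exact: lE.
(* This is the cofinite subset of [S] called T in the overview. *)
pose Y : set D := [set y | S y /\ y \notin l].
have esY x : x \in es -> centralizer Y x by move=> xes y [Sy yl]; apply: lE.
have Kcomm x y : K x -> K y -> x * y = y * x.
  by move=> Kx Ky; case: hK => _; apply; rewrite in_setE.
have FK : center (D := D) `<=` K.
  by rewrite KE => x Fx B [_ FB]; apply: FB; left.
(* If [x] centralizes [K], then [K] together with [x] is a commuting set; its double centralizer is
   a subfield containing [K], hence [K] by maximality. *)
have cK : centralizer K `<=` K.
  move=> x cx; pose L := centralizer (centralizer (x |` K)).
  have xKC : x |` K `<=` centralizer (x |` K).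
    by move=> u [->|Ku] v [->|Kv] //; [apply: cx | rewrite cx | apply: Kcomm].
  have xKL : x |` K `<=` L by move=> u uK v vC; rewrite vC.
  suff <- : L = K by apply: xKL; left.
  apply: Kmax; last by move=> u Ku; apply: xKL; right.
  split; first exact: centralizer_division_subring.
  move=> u v; rewrite !in_setE => Lu Lv.
  by apply: Lu => w /xKC; apply: Lv.
have YlS : Y `|` [set` l] = S.
  apply/seteqP; split=> y /=; first by move=> [[]|/lS].
  by move=> Sy; have [yl|yl] := boolP (y \in l); [right | left].
(* The centralizer of [x] is a division subring; containing F and [S], it contains F(S), which is
   [K]. *)
have cS : centralizer S `<=` K.
  move=> x cx; apply: cK => y; rewrite KE => /(_ (centralizer [set x])) yx.
  symmetry; apply: yx => //; split; first exact: centralizer_division_subring.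
  by move=> z [Fz|Sz] _ ->; [apply: Fz | symmetry; apply: cx].
have [||ws wsY wsp] := @centralizer_tower _ hD Y l.
- move=> x y yP xl; apply: Kcomm; first by apply/SK/lS.
  by apply: SK; case: yP => [[]|/lS].
- by move=> x _; apply: alg.
rewrite YlS in wsp.
have [sK Kinv] := (division_subringP _).1 (proj1 hK).
have {wsp}wsp : centralizer Y `<=` span K ws.
  by move=> x /wsp; apply: sub_span.
have [vs [vsub ind vsp]] := span_basis ws sK.
have {vsub}vsY v : v \in vs -> centralizer Y v by move=> /vsub/wsY.
have {vsp wsp}vsp : centralizer Y `<=` span K vs by move=> x /wsp/vsp.
have [Y1 _ YM] := centralizer_subring Y.
(* Listing 1 puts it into M; the products stay in the centralizer of [Y], which is a ring. *)
have [|cs csK csR] := @span_coefs D K vs (1 :: [seq x * v | x <- es, v <- vs]).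
  move=> x; rewrite in_cons => /predU1P[->|]; first exact: vsp.
  move=> /allpairsP[[e v] /= [/esY Ye /vsY Yv ->]]; apply: vsp; exact: YM.
have [R [sR RK Rcs Rfin]] := zariski_subfield hD hK csK.
have {}csR := csR R Rcs.
have R1 : span R vs 1 by apply: csR; rewrite mem_head.
pose E := span_stabilizer R vs.
have sE : subring E := span_stabilizer_subring vs sR.
have esE x : x \in es -> E x.
  move=> xes; apply: span_stabilizerP => // v vvs; apply: csR.
  by rewrite in_cons; apply/orP; right; apply/allpairsP; exists (x, v).
have NE' : N `<=` GL_entries_in E.
  move=> g; rewrite NE => /(_ (GL_entries_in E)); apply; split.
    exact: GL_entries_in_subgroup.
  move=> h; rewrite XE => /= hgs i j.
  by have [? ?] := esg h i j hgs; split; apply: esE.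
have FE : center (D := D) `<=` E.
  move=> a Fa; have [->|a0] := eqVneq a 0; first exact: subring0.
  have aV : (a%:M : 'M[D]_n) *m (a^-1)%:M = 1%:M.
    by rewrite -scalar_mxM divring_mulrV.
  have Va : (a^-1)%:M *m (a%:M : 'M[D]_n) = 1%:M.
    by rewrite -scalar_mxM divring_mulVr.
  have gP : ((a%:M : 'M[D]_n) *m (a^-1)%:M == 1%:M) &&
      ((a^-1)%:M *m (a%:M : 'M[D]_n) == 1%:M) by rewrite aV Va eqxx.
  pose g : GL D n := @MkGL D n (a%:M, (a^-1)%:M) gP.
  have /NE' gE : N g by apply: hFN; exists a.
  (* As [n] is at least 1 there is a diagonal entry, and it equals [a]. *)
  have [+ _] := gE (Ordinal hn) (Ordinal hn).
  by rewrite /= mxE eqxx.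
have [v vvs] : exists v, v \in vs.
  case: (vs) R1 => [/= /eqP|v vs' _]; first by rewrite oner_eq0.
  by exists v; rewrite mem_head.
have FR : center (D := D) `<=` R.
  move=> a Fa; apply: (independent_coef hD (proj1 hK) RK sR ind vvs (FK a Fa)).
  by rewrite -Fa; apply: (FE a Fa); apply: mem_span.
have finR : finite_set R.
  by apply: Rfin => x Rx; apply: algebraic_inv_mem.
have finE : finite_set E.
  apply: sub_finite_set (finite_span vs finR) => x /(_ 1 R1).
  by rewrite mulr1.
(* As [E] contains F, it contains the inverse of each of its elements, all of them being
   algebraic. *)
have dE : division_subring E.
  apply/division_subringP; split=> // x Ex.
  exact: (algebraic_inv_mem hD sE FE (alg x)).
have := finite_sub_divring_comm hD dE finE.
move=> /(_ x0 y0); rewrite !in_setE => comm.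
by case/eqP: xy0; apply: comm; apply: esE; rewrite !inE eqxx ?orbT.
Qed.
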